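(* Let $(G,c)$ be a colored DAG and let $S_G=\{\prod_{i\in V}|\Sigma_{\mathrm{pa}_G(i)}|^{k_i}: k_i\in\mathbb N\}$ be the multiplicatively closed set generated by the parental principal minors. Then the vanishing ideal $P_{G,c}$ of $\mathcal M(G,c)$ equals $I_{G,c}:S_G$.
   Context: $\mathbb R[\Sigma]$ is the polynomial ring in symmetric variables $\sigma_{ij}=\sigma_{ji}$; $\Sigma_B$ principal submatrix (with $|\Sigma_\emptyset|=1$); $\Sigma_{ij|K}$ the submatrix with rows $(i,K)$, columns $(j,K)$; $J:S=\{f: fs\in J\text{ for some } s\in S\}$. $G=(V,E)$ a DAG with $V=[p]$ naturally ordered; $c:V\sqcup E\to C$, $c(V)\cap c(E)=\emptyset$. $\mathcal M(G,c)$ is the set of $(I-\Lambda)^{-T}\Omega(I-\Lambda)^{-1}$ with $\Omega=\mathrm{diag}(\omega_i)$, $\omega_i>0$, $\lambda_{ij}=0$ for $ij\notin E$, $\omega_i=\omega_k$ when $c(i)=c(k)$, $\lambda_{ij}=\lambda_{kl}$ when $c(ij)=c(kl)$; $P_{G,c}$ is the ideal of polynomials vanishing on $\mathcal M(G,c)$. $I_{G,c}$ is generated by: $|\Sigma_{ij|\mathrm{pa}(j)}|$ for $i<j$, $ij\notin E$; $|\Sigma_{\{i\}\cup\mathrm{pa}(i)}|\,|\Sigma_{\mathrm{pa}(j)}|-|\Sigma_{\{j\}\cup\mathrm{pa}(j)}|\,|\Sigma_{\mathrm{pa}(i)}|$ for $c(i)=c(j)$; $|\Sigma_{ij|\mathrm{pa}(j)\setminus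 i}|\,|\Sigma_{\mathrm{pa}(l)}|-|\Sigma_{kl|\mathrm{pa}(l)\setminus k}|\,|\Sigma_{\mathrm{pa}(j)}|$ for $c(ij)=c(kl)$. *)

(* Defs.v *)
From HB Require Import structures.
From mathcomp Require Import all_boot all_order all_algebra.
From mathcomp Require Import reals.
From mathcomp Require Import mpoly.

Set Implicit Arguments.
Unset Strict Implicit.
Unset Printing Implicit Defensive.

Import Order.TTheory GRing.Theory Num.Theory.
Local Open Scope ring_scope.

Section Gaussian.
Variables (R : realType) (p : nat).

(* index type of the symmetric variables sigma_ij, i <= j *)
Definition sym_idx := {ij : 'I_p * 'I_p | (ij.1 <= ij.2)%N}.
Definition nvars : nat := #|{: sym_idx}|.

Definition sym_pair (i j : 'I_p) : 'I_p * 'I_p := if (i <= j)%N then (i, j) else (j, i).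
Lemma sym_pair_le (i j : 'I_p) : ((sym_pair i j).1 <= (sym_pair i j).2)%N.
Proof.
rewrite /sym_pair; case: (leqP i j) => [//|h] /=; exact: ltnW.
Qed.

Definition sidx (i j : 'I_p) : 'I_nvars :=
  enum_rank (exist (fun ij : 'I_p * 'I_p => (ij.1 <= ij.2)%N) (sym_pair i j) (sym_pair_le i j)).

Definition polyS := {mpoly R[nvars]}.

Definition Sig : 'M[polyS]_p := \matrix_(i, j) 'X_(sidx i j).

(* principal minor |Sigma_B| for B a set of vertices (|Sigma_emptyset| = 1) *)
Definition pminor (B : {set 'I_p}) : polyS :=
  let s := in_tuple (enum B) in
  \det (\matrix_(a, b) Sig (tnth s a) (tnth s b)).

(* |Sigma_{ij|K}|: rows (i,K), columns (j,K), K in increasing order *)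
Definition cminor (i j : 'I_p) (K : {set 'I_p}) : polyS :=
  let k := enum K in
  \det (\matrix_(a < (size k).+1, b < (size k).+1)
          Sig (nth i (i :: k) a) (nth j (j :: k) b)).

Definition evalS (S : 'M[R]_p) (f : polyS) : R :=
  f.@[fun k : 'I_nvars => let ij := val (enum_val k) in S ij.1 ij.2].

Section Graph.
(* DAG on [p], naturally ordered: E i j means edge i -> j, requires i < j *)
Variables (E : rel 'I_p) (C : eqType) (cV : 'I_p -> C) (cE : 'I_p -> 'I_p -> C).

Definition pa (j : 'I_p) : {set 'I_p} := [set i | E i j].

Definition model (S : 'M[R]_p) : Prop :=
  exists (lam : 'I_p -> 'I_p -> R) (om : 'I_p -> R),
    [/\ (forall i j, ~~ E i j -> lam i j = 0),
        (forall i, 0 < om i),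
        (forall i k, cV i = cV k -> om i = om k),
        (forall i j k l, E i j -> E k l -> cE i j = cE k l -> lam i j = lam k l) &
        let L : 'M[R]_p := \matrix_(i, j) lam i j in
        S = (invmx (1%:M - L))^T *m diag_mx (\row_i om i) *m invmx (1%:M - L)].

Definition vanishing_ideal (f : polyS) : Prop := forall S, model S -> evalS S f = 0.

Definition gens (g : polyS) : Prop :=
  (exists i j : 'I_p, [/\ (i < j)%N, ~~ E i j & g = cminor i j (pa j)]) \/
  (exists i j : 'I_p, cV i = cV j /\
     g = pminor (i |: pa i) * pminor (pa j) - pminor (j |: pa j) * pminor (pa i)) \/
  (exists i j k l : 'I_p, [/\ E i j, E k l, cE i j = cE k l &
     g = cminor i j (pa j :\ i) * pminor (pa l) - cminor k l (pa l :\ k) * pminor (pa j)]).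

End Graph.

Definition ideal_gen (A : polyS -> Prop) (f : polyS) : Prop :=
  exists n (h a : 'I_n -> polyS), (forall k, A (a k)) /\ f = \sum_(k < n) h k * a k.

Definition colon (J S : polyS -> Prop) (f : polyS) : Prop :=
  exists s, S s /\ J (f * s).

Definition parental_mset (E : rel 'I_p) (s : polyS) : Prop :=
  exists k : 'I_p -> nat, s = \prod_(i < p) pminor (pa E i) ^+ k i.

End Gaussian.

(* Main.v *)
(** In the localization of [R[Sigma]] at the parental principal minors, Cramer's
    rule yields regression coefficients
    [lambda_ij = |Sigma_{ij|pa(j)\i}| / |Sigma_pa(j)|]
    and residual variances [omega_j = |Sigma_{j,pa(j)}| / |Sigma_pa(j)|].  By the
    Schur complement formula, the conditional independence generators of
    [I_{G,c}] say that [(I - Lambda)^T Sigma (I - Lambda)] is congruent to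
    [Omega], and the colour generators say that [Lambda] and [Omega] are
    constant on colour classes.  Hence [Sigma] is congruent to the model
    parametrization evaluated at elements of the localization.  If [f] vanishes
    on the model, its composite with the parametrization is the zero polynomial,
    so [f] is congruent to 0, that is [f s] lies in [I_{G,c}] for a product [s]
    of parental minors.  Conversely the generators vanish on the model, whose
    positive definite matrices have nonzero principal minors.  All congruences
    are computed inside the fraction field of [R[Sigma]]. *)

Require Import Defs.
From HB Require Import structures.
From mathcomp Require Import all_boot all_order all_algebra all_fingroup.
From mathcomp Require Import reals.
From mathcomp Require Import mpoly.
Import Order.TTheory GRing.Theory Num.Theory.
Local Open Scope ring_scope.

Set Implicit Arguments.
Unset Strict Implicit.
Unset Printing Implicit Defensive.

(** * Minors and linear systems *)

Section Minors.
Variables (T : comNzRingType) (p : nat) (S : 'M[T]_p).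

Definition pminor_of (B : {set 'I_p}) : T :=
  let s := in_tuple (enum B) in
  \det (\matrix_(a, b) S (tnth s a) (tnth s b)).

Definition cminor_of (i j : 'I_p) (K : {set 'I_p}) : T :=
  let k := enum K in
  \det (\matrix_(a < (size k).+1, b < (size k).+1)
          S (nth i (i :: k) a) (nth j (j :: k) b)).

Lemma sum_enum_tnth (K : {set 'I_p}) (F : 'I_p -> T) :
  \sum_(k in K) F k = \sum_b F (tnth (in_tuple (enum K)) b).
Proof. by rewrite -big_enum big_tnth. Qed.

(** Rows and columns are permuted together, so the sign of the permutation enters squared. *)
Lemma det_perm_eq n (x : 'I_p) (s t : seq 'I_p) : size s = n -> perm_eq s t ->
  \det (\matrix_(a < n, b < n) S (nth x s a) (nth x s b)) =
  \det (\matrix_(a < n, b < n) S (nth x t a) (nth x t b)).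
Proof.
move=> szs pst; have szt : size t = n by rewrite -(perm_size pst).
pose s' : n.-tuple _ := Tuple (introT eqP szs).
pose t' : n.-tuple _ := Tuple (introT eqP szt).
have /tuple_permP[q /= sE] : perm_eq s' t' by [].
set A := (X in _ = \det X).
suff -> : (\matrix_(a < n, b < n) S (nth x s a) (nth x s b)) =
   row_perm q (col_perm q A).
  rewrite row_permE col_permE !det_mulmx !det_perm odd_permV.
  by rewrite mulrCA -expr2 sqrr_sign mulr1.
have sq (a : 'I_n) : nth x s a = nth x t (q a).
  by rewrite sE (nth_map a) ?size_enum_ord // nth_ord_enum (tnth_nth x).
by apply/matrixP=> a b; rewrite !mxE !sq.
Qed.

Lemma pminor_ofU1 i (K : {set 'I_p}) :
  i \notin K -> pminor_of (i |: K) = cminor_of i i K.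
Proof.
move=> iK; rewrite /pminor_of /cminor_of.
have pE : perm_eq (enum (i |: K)) (i :: enum K).
  apply: uniq_perm; rewrite ?enum_uniq //= ?mem_enum ?iK ?enum_uniq //.
  by move=> x; rewrite !(mem_enum, inE).
have szE : size (enum (i |: K)) = (size (enum K)).+1 by rewrite (perm_size pE).
rewrite -(det_perm_eq i szE pE) -szE; congr (\det _).
by apply/matrixP=> a b; rewrite !mxE !(tnth_nth i).
Qed.

Lemma cminor_of_block i j (K : {set 'I_p}) : let k := tnth (in_tuple (enum K)) in
  cminor_of i j K =
  \det (block_mx (S i j)%:M (\row_b S i (k b)) (\col_a S (k a) j)
                 (\matrix_(a, b) S (k a) (k b))).
Proof.
move=> k; rewrite /cminor_of; set A := \matrix_(_, _) _.
have ul : @ulsubmx _ 1 _ 1 _ A = (S i j)%:M.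
  by apply/matrixP=> a b; rewrite !mxE !ord1.
have ur : @ursubmx _ 1 _ 1 _ A = \row_b S i (k b).
  by apply/matrixP=> a b; rewrite !mxE !ord1 /k (tnth_nth j).
have dl : @dlsubmx _ 1 _ 1 _ A = \col_a S (k a) j.
  by apply/matrixP=> a b; rewrite !mxE !ord1 /k (tnth_nth i).
have dr : @drsubmx _ 1 _ 1 _ A = \matrix_(a, b) S (k a) (k b).
  by apply/matrixP=> a b; rewrite !mxE /k (tnth_nth i) [tnth _ b](tnth_nth j).
by rewrite -ul -ur -dl -dr submxK.
Qed.

(** A column operation subtracts the [x]-combination of the [K]-columns from the first column and
    clears it below the corner. Working with a solution [x] instead of an inverse of the [K]-block
    keeps the Schur complement formula valid over any commutative ring. *)
Lemma cminor_of_schur i j (K : {set 'I_p}) (x : 'I_p -> T) :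
    (forall a, a \in K -> S a j = \sum_(k in K) S a k * x k) ->
  cminor_of i j K = pminor_of K * (S i j - \sum_(k in K) S i k * x k).
Proof.
move=> xP; rewrite cminor_of_block; set k := tnth _; set A := block_mx _ _ _ _.
pose B := block_mx 1%:M 0 (\col_a - x (k a)) 1%:M : 'M[T]_(1 + size (enum K)).
have -> : \det A = \det (A *m B) by rewrite det_mulmx det_lblock !det1 !mulr1.
suff -> : A *m B = block_mx (S i j - \sum_(k in K) S i k * x k)%:M
    (\row_b S i (k b)) 0 (\matrix_(a, b) S (k a) (k b)).
  by rewrite det_ublock det_scalar1 mulrC.
rewrite mulmx_block !mulmx1 !mulmx0 !add0r; congr (block_mx _ _ _ _).
  apply/matrixP=> a b; rewrite !mxE !ord1 /= !mulr1n sum_enum_tnth -sumrN.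
  by congr (_ + _); apply: eq_bigr=> c _; rewrite !mxE mulrN.
apply/matrixP=> a b; rewrite !mxE xP; last by rewrite -mem_enum mem_tnth.
rewrite sum_enum_tnth; apply/eqP; rewrite addr_eq0 -sumrN; apply/eqP.
by apply: eq_bigr=> c _; rewrite !mxE mulrN opprK.
Qed.

(** Cramer's rule as a column operation: right multiplication by [B] turns the column of [i] into
    the right-hand side of the system, at the price of the factor [x i]. *)
Lemma cminor_of_cramer i j (K : {set 'I_p}) (x : 'I_p -> T) :
    i \notin K ->
    (forall a, a \in i |: K -> S a j = \sum_(k in i |: K) S a k * x k) ->
  cminor_of i j K = pminor_of (i |: K) * x i.
Proof.
move=> iK xP; rewrite (pminor_ofU1 iK) !cminor_of_block; set k := tnth _.
set A := (X in _ = \det X * _).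
pose B := block_mx (x i)%:M 0 (\col_a x (k a)) 1%:M : 'M[T]_(1 + size (enum K)).
have -> : \det A * x i = \det (A *m B).
  by rewrite det_mulmx det_lblock det1 det_scalar1 mulr1.
rewrite mulmx_block !mulmx1 !mulmx0 !add0r; congr (\det (block_mx _ _ _ _)).
  apply/matrixP=> a b; rewrite !mxE !ord1 /= !mulr1n xP ?setU11 //.
  rewrite big_setU1 //= sum_enum_tnth big_ord1 !mxE /= !mulr1n.
  by congr (_ + _); apply: eq_bigr=> c _; rewrite !mxE.
apply/matrixP=> a b; rewrite !mxE !ord1 /= xP; last first.
  by rewrite setU1r // -mem_enum mem_tnth.
rewrite big_setU1 //= sum_enum_tnth big_ord1 !mxE /= !mulr1n.
by congr (_ + _); apply: eq_bigr=> c _; rewrite !mxE.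
Qed.

End Minors.

Lemma pminor_of_solve (F : fieldType) p (S : 'M[F]_p) (B : {set 'I_p}) j :
  pminor_of S B != 0 ->
  exists x : 'I_p -> F, (forall k, k \notin B -> x k = 0) /\
    (forall a, a \in B -> S a j = \sum_(k in B) S a k * x k).
Proof.
rewrite /pminor_of; set k := in_tuple _; set A := \matrix_(_, _) _ => dA.
have uA : A \in unitmx by rewrite unitmxE unitfE.
pose y := invmx A *m (\col_a S (tnth k a) j).
(* The sum has one term, at the position of [i] in the enumeration of [B]; it is empty, hence 0, for
   [i] outside [B]. *)
exists (fun i => \sum_(b | tnth k b == i) y b 0); split=> [i iB|a aB].
  by rewrite big1 // => b /eqP bi; rewrite -mem_enum -bi mem_tnth in iB.
have /tnthP[a' ->] : a \in k by rewrite mem_enum.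
have /matrixP/(_ a' 0) : A *m y = \col_a S (tnth k a) j by rewrite mulKVmx.
rewrite !mxE => <-; rewrite sum_enum_tnth; apply: eq_bigr=> b _.
rewrite mxE; congr (_ * _); rewrite (big_pred1 b) // => c /=.
by apply/eqP/eqP=> [|->//]; apply/tuple_uniqP/enum_uniq.
Qed.

Lemma rmorph_pminor_of (T U : comNzRingType) (g : {rmorphism T -> U}) p
  (S : 'M[T]_p) B : g (pminor_of S B) = pminor_of (map_mx g S) B.
Proof.
by rewrite /pminor_of -det_map_mx; congr (\det _); apply/matrixP=> a b; rewrite !mxE.
Qed.

Lemma rmorph_cminor_of (T U : comNzRingType) (g : {rmorphism T -> U}) p
  (S : 'M[T]_p) i j K : g (cminor_of S i j K) = cminor_of (map_mx g S) i j K.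
Proof.
by rewrite /cminor_of -det_map_mx; congr (\det _); apply/matrixP=> a b; rewrite !mxE.
Qed.

(** * Specialization and congruences in a localization *)

Lemma rmorph_mmap (A : nzRingType) (T U : comNzRingType)
    (g : {rmorphism T -> U}) (f : A -> T) n (h : 'I_n -> T) (q : {mpoly A[n]}) :
  g (mmap f h q) = mmap (g \o f) (g \o h) q.
Proof.
rewrite /mmap rmorph_sum; apply: eq_bigr=> m _; rewrite rmorphM; congr (_ * _).
by rewrite /mmap1 rmorph_prod; apply: eq_bigr=> i _; rewrite rmorphXn.
Qed.

Lemma eq_mmap (A S : nzRingType) (f f' : A -> S) n (h h' : 'I_n -> S)
    (q : {mpoly A[n]}) :
  f =1 f' -> h =1 h' -> mmap f h q = mmap f' h' q.
Proof.
by move=> ff hh; apply: eq_bigr=> m _; rewrite ff; congr (_ * _); apply: mmap1_eq.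
Qed.

Lemma mmap_polyX (A : comNzRingType) n (q : {mpoly A[n]}) :
  mmap (@mpolyC n A) (fun i => 'X_i) q = q.
Proof.
rewrite [RHS]mpolyE /mmap; apply: eq_bigr=> m _.
by rewrite mul_mpolyC mmap1_id.
Qed.

(* Positive scalars are replaced by arbitrary elements of [D] one variable at a
   time, since a univariate polynomial with infinitely many roots is zero. *)
Lemma mmap_eq0_of_pos (R : realFieldType) (D : idomainType)
    (g : {rmorphism R -> D}) n (q : {mpoly R[n]}) :
    (forall v : 'I_n -> R, (forall i, 0 < v i) -> q.@[v] = 0) ->
  forall w : 'I_n -> D, mmap g w q = 0.
Proof.
move=> q0 w.
have H k : (k <= n)%N -> forall w : 'I_n -> D,
    (forall i : 'I_n, (k <= i)%N -> exists2 c, 0 < c & w i = g c) ->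
  mmap g w q = 0.
  elim: k => [_ {}w wP|k IH kn {}w wP].
    have /fin_all_exists2[v v0 vw] : forall i : 'I_n, exists2 c, 0 < c & w i = g c.
      by move=> i; apply: wP.
    rewrite (@eq_mmap _ _ g (g \o idfun) _ w (g \o v)) // -rmorph_mmap.
    by rewrite -/(meval v q) q0 // rmorph0.
  pose k' := Ordinal kn.
  (* [G] is [q] read as a univariate polynomial in variable [k], the other variables being frozen at
     [w]. *)
  pose G : {poly D} := mmap (polyC \o g)
    (fun i => if i == k' then 'X else (w i)%:P) q.
  have GE d : G.[d] = mmap g (fun i => if i == k' then d else w i) q.
    rewrite -/(horner_eval d G) rmorph_mmap; apply: eq_mmap=> i /=.
      by rewrite /horner_eval hornerC.
    by rewrite /horner_eval; case: eqP; rewrite ?hornerX ?hornerC.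
  suff G0 : G = 0.
    rewrite (@eq_mmap _ _ g g _ w (fun i => if i == k' then w k' else w i)) //.
      by rewrite -GE G0 horner0.
    by move=> i; case: eqP=> [->|].
  apply/eqP/negPn/negP=> Gn0.
  (* The scalars 1, ..., [size G] are positive, so the induction hypothesis makes their images roots
     of [G]; that is one root more than the degree allows. *)
  pose rs := [seq g i.+1%:R | i <- iota 0 (size G)].
  suff : (size rs < size G)%N by rewrite size_map size_iota ltnn.
  apply: max_poly_roots=> //.
    apply/allP=> _ /mapP[i _ ->]; rewrite /root GE; apply/eqP/IH; first exact: ltnW.
    move=> j kj; case: eqP=> [_|/eqP jk]; first by exists i.+1%:R; rewrite ?ltr0Sn.
    apply: wP; rewrite ltn_neqAle kj andbT eq_sym.
    by apply: contraNN jk => /eqP jk; apply/eqP/val_inj.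
  rewrite map_inj_uniq ?iota_uniq // => i j /fmorph_inj /eqP.
  by rewrite eqr_nat => /eqP[].
by apply: (H n (leqnn n) w) => i; rewrite leqNgt ltn_ord.
Qed.

(** * Congruence modulo [J] in the localization at [M] *)

Section LocalCongruence.
Variables (A : idomainType) (M J : A -> Prop).
Hypotheses (M1 : M 1) (MM : forall s t, M s -> M t -> M (s * t)).
Hypotheses (J0 : J 0) (JD : forall a b, J a -> J b -> J (a + b)).
Hypothesis (JM : forall a b, J b -> J (a * b)).

Local Notation K := {fraction A}.
Local Notation "x %:F" := (@tofrac A x).

(** The localization of [I] at [M], inside the fraction field. The cross-multiplied form lets the
    closure lemmas for sums and products go through without asking that 0 lie outside [M]. *)
Definition localized (I : A -> Prop) (x : K) : Prop :=
  exists s a, [/\ M s, I a & x * s%:F = a%:F].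

(** Both sides are required to lie in the localization, so that congruences can be multiplied. The
    relation is therefore reflexive only on the localization, and [eqloc x x] expresses
    membership. *)
Definition eqloc (x y : K) : Prop :=
  [/\ localized (fun=> True) x, localized (fun=> True) y & localized J (x - y)].

Lemma localizedD (I : A -> Prop) x y :
    (forall a b, I a -> I b -> I (a + b)) -> (forall a b, I b -> I (a * b)) ->
  localized I x -> localized I y -> localized I (x + y).
Proof.
move=> ID IM [s [a [Ms Ia xs]]] [t [b [Mt Ib yt]]].
exists (s * t), (t * a + s * b); split; first exact: MM.
  by apply: ID; apply: IM.
rewrite tofracD !tofracM -xs -yt mulrDl; congr (_ + _); last by rewrite mulrCA.
by rewrite [RHS]mulrCA [t%:F * _]mulrC.
Qed.

Lemma localizedM (I : A -> Prop) x y :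
    (forall a b, I b -> I (a * b)) ->
  localized (fun=> True) x -> localized I y -> localized I (x * y).
Proof.
move=> IM [s [a [Ms _ xs]]] [t [b [Mt Ib yt]]].
exists (s * t), (a * b); split; [exact: MM | exact: IM | ].
by rewrite !rmorphM /= -xs -yt mulrACA.
Qed.

Lemma localized_tofrac (I : A -> Prop) a : I a -> localized I a%:F.
Proof. by move=> Ia; exists 1, a; split; rewrite // rmorph1 mulr1. Qed.

Lemma localized_div (I : A -> Prop) a s :
  s != 0 -> M s -> I a -> localized I (a%:F / s%:F).
Proof. by move=> s0 Ms Ia; exists s, a; split; rewrite // divfK ?tofrac_eq0. Qed.

Lemma localizedN (I : A -> Prop) x :
  (forall a b, I b -> I (a * b)) -> localized I x -> localized I (- x).
Proof.
move=> IM Ix; rewrite -mulN1r; apply: localizedM => //.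
by rewrite -(rmorph1 (@tofrac A)) -rmorphN; apply: localized_tofrac.
Qed.

Lemma eqloc_refl x : localized (fun=> True) x -> eqloc x x.
Proof.
by move=> Lx; split; rewrite // subrr -(rmorph0 (@tofrac A)); apply: localized_tofrac.
Qed.

Lemma eqloc_tofrac a : eqloc a%:F a%:F.
Proof. by apply/eqloc_refl/localized_tofrac. Qed.

Lemma eqloc0 : eqloc 0 0.
Proof. by rewrite -(rmorph0 (@tofrac A)); apply: eqloc_tofrac. Qed.

Lemma eqloc1 : eqloc 1 1.
Proof. by rewrite -(rmorph1 (@tofrac A)); apply: eqloc_tofrac. Qed.

Lemma eqloc_sym x y : eqloc x y -> eqloc y x.
Proof. by case=> Lx Ly Nxy; split=> //; rewrite -opprB; apply: localizedN. Qed.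

Lemma eqloc_trans x y z : eqloc x y -> eqloc y z -> eqloc x z.
Proof.
case=> Lx Ly Nxy [_ Lz Nyz]; split=> //.
by rewrite -[x](subrK y) -addrA; apply: localizedD.
Qed.

Lemma eqlocD x x' y y' : eqloc x x' -> eqloc y y' -> eqloc (x + y) (x' + y').
Proof.
case=> Lx Lx' Nx [Ly Ly' Ny]; split; try exact: localizedD.
by rewrite opprD addrACA; apply: localizedD.
Qed.

Lemma eqlocM x x' y y' : eqloc x x' -> eqloc y y' -> eqloc (x * y) (x' * y').
Proof.
case=> Lx Lx' Nx [Ly Ly' Ny]; split; try exact: localizedM.
have -> : x * y - x' * y' = y * (x - x') + x' * (y - y').
  by rewrite !mulrBr addrA [y * x]mulrC [y * x']mulrC subrK.
by apply: localizedD => //; apply: localizedM.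
Qed.

Lemma eqlocN x x' : eqloc x x' -> eqloc (- x) (- x').
Proof.
by move=> xx; rewrite -mulN1r -(mulN1r x') -(rmorph1 (@tofrac A)) -rmorphN;
   apply: eqlocM => //; apply: eqloc_tofrac.
Qed.

(** The cross difference has the shape of the colour generators, which thus become equalities of
    regression coefficients or of residual variances. *)
Lemma eqloc_div a b s t : s != 0 -> t != 0 -> M s -> M t ->
  J (a * t - b * s) -> eqloc (a%:F / s%:F) (b%:F / t%:F).
Proof.
move=> s0 t0 Ms Mt Jab; split; try exact: localized_div.
rewrite -mulNr addf_div ?tofrac_eq0 // mulNr -!tofracM -tofracB.
by apply: localized_div; rewrite ?mulf_neq0 //; apply: MM.
Qed.

Lemma eqloc_sum (I : finType) (F G : I -> K) :
  (forall i, eqloc (F i) (G i)) -> eqloc (\sum_i F i) (\sum_i G i).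
Proof. by move=> FG; apply: big_ind2 => //; [exact: eqloc0 | exact: eqlocD]. Qed.

Lemma eqloc_prod (I : finType) (F G : I -> K) :
  (forall i, eqloc (F i) (G i)) -> eqloc (\prod_i F i) (\prod_i G i).
Proof. by move=> FG; apply: big_ind2 => //; [exact: eqloc1 | exact: eqlocM]. Qed.

Lemma eqlocX n x y : eqloc x y -> eqloc (x ^+ n) (y ^+ n).
Proof.
by move=> xy; elim: n => [|n IH]; rewrite ?exprS; [exact: eqloc1 | exact: eqlocM].
Qed.

Lemma eqloc_mmap (R : nzRingType) (g : R -> A) n (x y : 'I_n -> K)
    (q : {mpoly R[n]}) :
    (forall i, eqloc (x i) (y i)) ->
  eqloc (mmap (@tofrac A \o g) x q) (mmap (@tofrac A \o g) y q).
Proof.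
move=> xy; apply: big_ind2; [exact: eqloc0 | exact: eqlocD |] => m _ /=.
apply: eqlocM; first exact: eqloc_tofrac.
by apply: eqloc_prod => i; apply: eqlocX.
Qed.

Definition eqlocmx m n (B C : 'M[K]_(m, n)) := forall i j, eqloc (B i j) (C i j).

Lemma eqlocmx_trans m n (B C D : 'M[K]_(m, n)) :
  eqlocmx B C -> eqlocmx C D -> eqlocmx B D.
Proof. by move=> BC CD i j; apply: eqloc_trans (CD i j). Qed.

Lemma eqlocmxM m n q (B B' : 'M[K]_(m, n)) (C C' : 'M[K]_(n, q)) :
  eqlocmx B B' -> eqlocmx C C' -> eqlocmx (B *m C) (B' *m C').
Proof. by move=> BB CC i j; rewrite !mxE; apply: eqloc_sum => k; apply: eqlocM. Qed.

Lemma eqlocmxB m n (B B' C C' : 'M[K]_(m, n)) :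
  eqlocmx B B' -> eqlocmx C C' -> eqlocmx (B - C) (B' - C').
Proof. by move=> BB CC i j; rewrite !mxE; apply/eqlocD/eqlocN. Qed.

Lemma eqlocmx_tr m n (B C : 'M[K]_(m, n)) : eqlocmx B C -> eqlocmx B^T C^T.
Proof. by move=> BC i j; rewrite !mxE. Qed.

Lemma eqlocmx1 n : eqlocmx (1%:M : 'M[K]_n) 1%:M.
Proof. by move=> i j; rewrite mxE; case: eqP => _; [exact: eqloc1 | exact: eqloc0]. Qed.

Lemma eqloc_det n (B C : 'M[K]_n) : eqlocmx B C -> eqloc (\det B) (\det C).
Proof.
move=> BC; apply: eqloc_sum => s; apply: eqlocM; last exact: eqloc_prod.
by apply/eqlocX/eqlocN/eqloc1.
Qed.

Lemma eqlocmx_adj n (B C : 'M[K]_n) : eqlocmx B C -> eqlocmx (\adj B) (\adj C).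
Proof.
move=> BC i j; rewrite !mxE; apply: eqlocM; first by apply/eqlocX/eqlocN/eqloc1.
by apply: eqloc_det => k l; rewrite !mxE.
Qed.

(** The way back from the fraction field to the colon ideal: clearing the denominator of a
    congruence to 0 exhibits the multiplier [s]. *)
Lemma eqloc_colon a : eqloc a%:F 0 -> exists s, M s /\ J (a * s).
Proof.
case=> _ _; rewrite subr0 => -[s [b [Ms Jb]]].
by rewrite -rmorphM => /eqP; rewrite tofrac_eq => /eqP asb; exists s; rewrite asb.
Qed.

End LocalCongruence.

(** * Covariance matrices of a linear recursive system *)

Section Covariance.
Variables (T : comNzRingType) (p : nat).

(* The adjugate stands for the inverse: [1%:M - L] has determinant 1 when [L] is
   strictly upper triangular, and adjugates commute with ring morphisms. *)
Definition cov (L : 'M[T]_p) (om : 'rV[T]_p) : 'M[T]_p :=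
  (\adj (1%:M - L))^T *m diag_mx om *m \adj (1%:M - L).

Lemma cov_sym L om : (cov L om)^T = cov L om.
Proof. by rewrite /cov !trmx_mul trmxK tr_diag_mx mulmxA. Qed.

Variable L : 'M[T]_p.
Hypothesis Lup : forall i j : 'I_p, (j <= i)%N -> L i j = 0.

Lemma det_1subL : \det (1%:M - L) = 1.
Proof.
rewrite -det_tr det_trig; last first.
  apply/is_trig_mxP=> i j ij; rewrite !mxE Lup ?(ltnW ij) // subr0.
  by rewrite -val_eqE /= gtn_eqF.
by rewrite big1 // => i _; rewrite !mxE eqxx Lup // subr0.
Qed.

Lemma mul_1subL_adj : (1%:M - L) *m \adj (1%:M - L) = 1%:M.
Proof. by rewrite mul_mx_adj det_1subL. Qed.

Lemma mul_adj_1subL : \adj (1%:M - L) *m (1%:M - L) = 1%:M.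
Proof. by rewrite mul_adj_mx det_1subL. Qed.

Lemma congr_cov om : (1%:M - L)^T *m cov L om *m (1%:M - L) = diag_mx om.
Proof.
rewrite /cov !mulmxA -trmx_mul mul_adj_1subL trmx1 mul1mx.
by rewrite -mulmxA mul_adj_1subL mulmx1.
Qed.

(** Valid for every [S]: once the inner factor is known to be congruent to a diagonal matrix, [S]
    itself is congruent to a [cov]. *)
Lemma cov_congr (S : 'M[T]_p) : S =
  (\adj (1%:M - L))^T *m ((1%:M - L)^T *m S *m (1%:M - L)) *m \adj (1%:M - L).
Proof.
rewrite -!mulmxA mul_1subL_adj mulmx1 !mulmxA -trmx_mul mul_1subL_adj trmx1.
by rewrite mul1mx.
Qed.

(** The matrix [U] solves a system with unit lower triangular matrix [(1%:M - L)^T] and diagonal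
    right-hand side. Forward substitution on [i] gives its entries with [i <= j], since each earlier
    [U k j] with [k < i] is off the diagonal and already 0. *)
Lemma cov_regression om (i j : 'I_p) : (i <= j)%N ->
  cov L om i j - \sum_k cov L om i k * L k j = om 0 j *+ (i == j).
Proof.
set S := cov L om.
have [U UD] : exists U, U = S *m (1%:M - L) by exists (S *m (1%:M - L)).
have UE a b : U a b = S a b - \sum_k S a k * L k b.
  by rewrite UD mulmxBr mulmx1 !mxE.
have DU a b : U a b - \sum_k L k a * U k b = om 0 b *+ (a == b).
  have := congr_cov om; rewrite -mulmxA -/S -UD => /matrixP/(_ a b).
  have -> : om 0 b *+ (a == b) = om 0 a *+ (a == b) by case: eqP => [->|].
  rewrite linearB /= trmx1 mulmxBl mul1mx !mxE => <-.
  by congr (_ - _); apply: eq_bigr => k _; rewrite mxE.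
rewrite -UE; have [n] := ubnP (i : nat); elim: n i => // n IH i lt_in ij.
rewrite -DU big1 ?subr0 // => k _; have [ik|ki] := leqP i k.
  by rewrite Lup ?mul0r.
rewrite IH ?(leq_trans ki) ?(ltnW (leq_trans ki ij)) //.
by rewrite -val_eqE /= ltn_eqF ?mulr0 // (leq_trans ki).
Qed.

End Covariance.

Lemma rmorph_cov (T U : comNzRingType) (g : {rmorphism T -> U}) p
    (L : 'M[T]_p) om : map_mx g (cov L om) = cov (map_mx g L) (map_mx g om).
Proof.
by rewrite /cov !map_mxM -map_trmx map_mx_adj map_diag_mx map_mxB map_mx1.
Qed.

Lemma cov_invmx (T : comUnitRingType) p (L : 'M[T]_p) om :
    (forall i j : 'I_p, (j <= i)%N -> L i j = 0) ->
  cov L om = (invmx (1%:M - L))^T *m diag_mx om *m invmx (1%:M - L).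
Proof.
move=> Lup; suff -> : invmx (1%:M - L) = \adj (1%:M - L) by [].
by rewrite /invmx unitmxE det_1subL // unitr1 invr1 scale1r.
Qed.

(** A kernel vector [v] of the submatrix, extended by zeros through the selection matrix [P] and
    transformed to [z], makes a sum of squares with weights [om] vanish. Positivity gives [z = 0],
    and invertibility of [1%:M - L] then gives [v = 0]. *)
Lemma cov_pminor_neq0 (R : realFieldType) p (L : 'M[R]_p) (om : 'rV[R]_p) B :
    (forall i j : 'I_p, (j <= i)%N -> L i j = 0) -> (forall i, 0 < om 0 i) ->
  pminor_of (cov L om) B != 0.
Proof.
move=> Lup om0; rewrite /pminor_of; set s := in_tuple _; apply/negP.
case/det0P=> v v0; set A := \matrix_(_, _) _ => vA.
pose P := \matrix_(a, k) (tnth s a == k)%:R : 'M[R]_(size (enum B), p).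
have PE (S : 'M[R]_p) a b : (P *m S *m P^T) a b = S (tnth s a) (tnth s b).
  rewrite mxE (bigD1 (tnth s b)) //= big1 ?addr0; last first.
    by move=> k kb; rewrite [P^T _ _]mxE [P _ _]mxE eq_sym (negPf kb) mulr0.
  rewrite [P^T _ _]mxE [P b _]mxE eqxx mulr1 mxE (bigD1 (tnth s a)) //= big1 ?addr0.
    by rewrite mxE eqxx mul1r.
  by move=> k ka; rewrite mxE eq_sym (negPf ka) mul0r.
pose z := v *m P *m (\adj (1%:M - L))^T.
have /matrixP/(_ 0 0) : z *m diag_mx om *m z^T = 0.
  have AE : A = P *m cov L om *m P^T by apply/matrixP=> a b; rewrite PE mxE.
  rewrite /z !trmx_mul trmxK -(mul0mx _ v^T) -vA AE /cov.
  by rewrite !mulmxA.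
rewrite mul_mx_diag !mxE => /eqP; rewrite psumr_eq0 => [/allP zz|k _]; last first.
  by rewrite !mxE mulrAC -expr2 mulr_ge0 ?sqr_ge0 ?(ltW (om0 _)).
have z0 : z = 0.
  apply/matrixP=> i k; rewrite ord1 [RHS]mxE; apply/eqP.
  have := zz k (mem_index_enum k); rewrite !mxE mulrAC -expr2 mulf_eq0.
  by rewrite (gt_eqF (om0 _)) orbF sqrf_eq0.
have vP : v *m P = 0.
  rewrite -[v *m P]mulmx1 -trmx1 -(mul_1subL_adj Lup) trmx_mul mulmxA.
  by rewrite -/z z0 mul0mx.
case/eqP: v0; apply/matrixP=> i a; rewrite ord1 [RHS]mxE.
have /matrixP/(_ 0 (tnth s a)) := vP; rewrite !mxE => <-.
rewrite (bigD1 a) //= big1 ?addr0 ?mxE ?eqxx ?mulr1 // => b ba.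
rewrite mxE; case: eqP => [sab|]; last by rewrite mulr0.
by case/eqP: ba; move: sab; apply/tuple_uniqP/enum_uniq.
Qed.

(** * The coloured model and its generators *)

HB.instance Definition _ (R : realType) p (S : 'M[R]_p) :=
  GRing.RMorphism.copy (evalS S)
    (meval (fun k : 'I_(nvars p) => S (val (enum_val k)).1 (val (enum_val k)).2)).

Section ColoredDAG.
Variables (R : realType) (p : nat) (E : rel 'I_p).
Variables (C : eqType) (cV : 'I_p -> C) (cE : 'I_p -> 'I_p -> C).
Hypothesis hnat : forall i j : 'I_p, E i j -> (i < j)%N.

Local Notation pa := (pa E).

Lemma pminor_ofE B : pminor R B = pminor_of (Sig R p) B.
Proof. by []. Qed.

Lemma cminor_ofE i j K : cminor R i j K = cminor_of (Sig R p) i j K.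
Proof. by []. Qed.

Lemma sidxC (i j : 'I_p) : sidx i j = sidx j i.
Proof.
congr enum_rank; apply: val_inj; rewrite /= /sym_pair.
by case: ltngtP => // /val_inj ->.
Qed.

Lemma Sig_sym : (Sig R p)^T = Sig R p.
Proof. by apply/matrixP=> i j; rewrite !mxE sidxC. Qed.

Lemma Sig_enum_val (k : 'I_(nvars p)) :
  Sig R p (val (enum_val k)).1 (val (enum_val k)).2 = 'X_k.
Proof.
rewrite mxE; congr ('X_ _); rewrite /sidx -[RHS]enum_valK; congr enum_rank.
apply: val_inj => /=; rewrite /sym_pair (valP (enum_val k)).
by case: (val (enum_val k)).
Qed.

(** Evaluation reads only the entries of [S] with row index at most the column index; symmetry
    restores the others. *)
Lemma map_Sig (S : 'M[R]_p) : S^T = S -> map_mx (evalS S) (Sig R p) = S.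
Proof.
move=> Ssym; apply/matrixP=> i j; rewrite !mxE /evalS mevalXU enum_rankK /=.
by rewrite /sym_pair; case: leqP => //= _; rewrite -{1}Ssym mxE.
Qed.

Lemma evalS_pminor (S : 'M[R]_p) B :
  S^T = S -> evalS S (pminor R B) = pminor_of S B.
Proof.
move=> Ssym; rewrite -{2}(map_Sig Ssym) pminor_ofE.
exact: (rmorph_pminor_of (evalS S)).
Qed.

Lemma evalS_cminor (S : 'M[R]_p) i j K :
  S^T = S -> evalS S (cminor R i j K) = cminor_of S i j K.
Proof.
move=> Ssym; rewrite -{2}(map_Sig Ssym) cminor_ofE.
exact: (rmorph_cminor_of (evalS S)).
Qed.

(** * Regression on the parents, and the generators on the model *)

Lemma pa_notin j : j \notin pa j.
Proof. by rewrite inE; apply/negP => /hnat; rewrite ltnn. Qed.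

Section Regression.
Variables (T : comNzRingType) (S : 'M[T]_p) (x : 'I_p -> 'I_p -> T).
Hypothesis xP : forall j a, a \in pa j -> S a j = \sum_(k in pa j) S a k * x k j.

(** The identities of this section serve twice: for a model matrix, with [x] its edge coefficients,
    and for the generic matrix over the fraction field, with [x] its regression coefficients. *)
Lemma cminor_of_regression i j :
  cminor_of S i j (pa j) =
  pminor_of S (pa j) * (S i j - \sum_(k in pa j) S i k * x k j).
Proof. by rewrite (@cminor_of_schur _ _ _ _ _ _ (x^~ j)) // => a; apply: xP. Qed.

Lemma pminor_of_regression j :
  pminor_of S (j |: pa j) =
  pminor_of S (pa j) * (S j j - \sum_(k in pa j) S j k * x k j).
Proof. by rewrite pminor_ofU1 ?pa_notin // cminor_of_regression. Qed.

Lemma cminor_of_coefficient i j : E i j ->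
  cminor_of S i j (pa j :\ i) = pminor_of S (pa j) * x i j.
Proof.
move=> Eij; have ipa : i \in pa j by rewrite inE.
rewrite (@cminor_of_cramer _ _ _ _ _ _ (x^~ j)) ?setD11 ?setD1K //.
by move=> a; apply: xP.
Qed.

End Regression.

Lemma model_cov S : model E cV cE S -> exists (L : 'M[R]_p) (om : 'rV[R]_p),
  [/\ (forall i j, ~~ E i j -> L i j = 0), (forall i, 0 < om 0 i),
      (forall i k, cV i = cV k -> om 0 i = om 0 k),
      (forall i j k l, E i j -> E k l -> cE i j = cE k l -> L i j = L k l) &
      S = cov L om].
Proof.
case=> lam [om [lam0 om0 omc lamc ->]].
exists (\matrix_(i, j) lam i j), (\row_i om i); split.
- by move=> i j ?; rewrite mxE lam0.
- by move=> i; rewrite mxE.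
- by move=> i k ?; rewrite !mxE; apply: omc.
- by move=> i j k l ? ? ?; rewrite !mxE; apply: lamc.
rewrite cov_invmx // => i j ij; rewrite mxE lam0 //.
by apply/negP => /hnat; rewrite ltnNge ij.
Qed.

Lemma DAG_upper (T : nzRingType) (L : 'M[T]_p) :
  (forall i j, ~~ E i j -> L i j = 0) ->
  forall i j : 'I_p, (j <= i)%N -> L i j = 0.
Proof.
by move=> L0 i j ij; apply: L0; apply/negP => /hnat; rewrite ltnNge ij.
Qed.

Lemma evalS_parental_mset S (s : polyS R p) :
  model E cV cE S -> parental_mset E s -> evalS S s != 0.
Proof.
move=> /model_cov[L [om [L0 om0 _ _ ->]]] [k ->].
rewrite rmorph_prod; apply/prodf_neq0 => i _; rewrite rmorphXn expf_neq0 //=.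
by rewrite evalS_pminor ?cov_sym // cov_pminor_neq0 //; apply: DAG_upper.
Qed.

(** On a model matrix the edge coefficients solve the parental regressions. Up to parental minors,
    the generators then evaluate to a residual covariance with [i < j], a difference of equal [om],
    or a difference of equal entries of [L]. *)
Lemma evalS_gens S (g : polyS R p) :
  model E cV cE S -> gens E cV cE g -> evalS S g = 0.
Proof.
move=> /model_cov[L [om [L0 om0 omc Lc ->]]]; set S' := cov L om.
have Ssym : S'^T = S' by apply: cov_sym.
have reg (i j : 'I_p) : (i <= j)%N ->
    S' i j - \sum_(k in pa j) S' i k * L k j = om 0 j *+ (i == j).
  move=> ij; rewrite -(cov_regression (DAG_upper L0) om ij); congr (_ - _).
  rewrite big_mkcond; apply: eq_bigr => k _; rewrite inE.
  by case: ifPn => // nE; rewrite L0 ?mulr0.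
have xP j a : a \in pa j -> S' a j = \sum_(k in pa j) S' a k * L k j.
  rewrite inE => /hnat aj; apply/eqP; rewrite -subr_eq0 reg ?(ltnW aj) //.
  by rewrite -val_eqE /= ltn_eqF.
case=> [[i [j [ij nE ->]]]|[[i [j [cij ->]]]|[i [j [k [l [Eij Ekl c ->]]]]]]].
- rewrite evalS_cminor // (cminor_of_regression xP) reg ?(ltnW ij) //.
  by rewrite -val_eqE /= ltn_eqF ?mulr0.
- rewrite rmorphB !rmorphM /= !evalS_pminor //.
  rewrite !(pminor_of_regression xP) !reg // !eqxx (omc _ _ cij).
  by rewrite [X in X - _]mulrC mulrA [X in X - _]mulrAC subrr.
- rewrite rmorphB !rmorphM /= !evalS_pminor // !evalS_cminor //.
  rewrite !(cminor_of_coefficient xP) // (Lc _ _ _ _ Eij Ekl c).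
  by rewrite [X in X - _]mulrC mulrA [X in X - _]mulrAC subrr.
Qed.

Lemma colon_vanishing (f : polyS R p) :
  colon (ideal_gen (gens E cV cE)) (parental_mset E) f ->
  vanishing_ideal E cV cE f.
Proof.
case=> s [Ss [n [h [a [aP fs]]]]] S MS; apply/eqP.
have : evalS S (f * s) == 0.
  rewrite fs rmorph_sum big1 // => k _.
  by rewrite rmorphM [X in _ * X](evalS_gens MS (aP k)) mulr0.
rewrite rmorphM mulf_eq0 /=.
by rewrite (negPf (evalS_parental_mset MS Ss)) orbF.
Qed.

(** * Closure properties of the multiplicative set and of the ideal *)

Lemma parental_mset1 : parental_mset (R := R) E 1.
Proof. by exists (fun=> 0%N); rewrite big1. Qed.

Lemma parental_msetM (s t : polyS R p) :
  parental_mset E s -> parental_mset E t -> parental_mset E (s * t).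
Proof.
case=> k -> [l ->]; exists (fun i => k i + l i)%N; rewrite -big_split /=.
by apply: eq_bigr => i _; rewrite exprD.
Qed.

Lemma parental_mset_pminor i : parental_mset E (pminor R (pa i)).
Proof.
exists (fun j => (i == j) : nat); rewrite (bigD1 i) //= eqxx expr1 big1 ?mulr1 //.
by move=> j; rewrite eq_sym => /negPf ->; rewrite expr0.
Qed.

Lemma ideal_gen0 (G : polyS R p -> Prop) : ideal_gen G 0.
Proof. by exists 0%N, (fun=> 0), (fun=> 0); split; [case|rewrite big_ord0]. Qed.

Lemma ideal_gen_mem (G : polyS R p -> Prop) g : G g -> ideal_gen G g.
Proof. by move=> Gg; exists 1%N, (fun=> 1), (fun=> g); rewrite big_ord1 mul1r. Qed.

Lemma ideal_genD (G : polyS R p -> Prop) f g :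
  ideal_gen G f -> ideal_gen G g -> ideal_gen G (f + g).
Proof.
case=> m [h [a [aP ->]]] [n [h' [a' [aP' ->]]]].
pose cat (u : 'I_m -> polyS R p) (v : 'I_n -> polyS R p) (k : 'I_(m + n)) :=
  match split k with inl i => u i | inr i => v i end.
exists (m + n)%N, (cat h h'), (cat a a'); split.
  by move=> k; rewrite /cat; case: splitP.
rewrite big_split_ord /=; congr (_ + _); apply: eq_bigr => k _; rewrite /cat.
  by rewrite (unsplitK (inl k)).
by rewrite (unsplitK (inr k)).
Qed.

Lemma ideal_genM (G : polyS R p -> Prop) f g : ideal_gen G g -> ideal_gen G (f * g).
Proof.
case=> m [h [a [aP ->]]]; exists m, (fun k => f * h k), a; split=> //.
by rewrite mulr_sumr; apply: eq_bigr => k _; rewrite mulrA.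
Qed.

(** * Colour class representatives and the generic parametrization *)

Definition repV (i : 'I_p) : 'I_p := odflt i [pick k | cV k == cV i].

Definition repE (i j : 'I_p) : 'I_p * 'I_p :=
  odflt (i, j) [pick e | E e.1 e.2 && (cE e.1 e.2 == cE i j)].

Lemma repV_color i : cV (repV i) = cV i.
Proof. by rewrite /repV; case: pickP => //= k /eqP. Qed.

Lemma eq_repV i k : cV i = cV k -> repV i = repV k.
Proof.
rewrite /repV => ->; case: pickP => //= /(_ k); by rewrite eqxx.
Qed.

Lemma repE_color i j : E i j ->
  E (repE i j).1 (repE i j).2 /\ cE (repE i j).1 (repE i j).2 = cE i j.
Proof. by rewrite /repE; case: pickP => //= e /andP[? /eqP]. Qed.

Lemma eq_repE i j k l : E k l -> cE i j = cE k l -> repE i j = repE k l.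
Proof.
by move=> Ekl; rewrite /repE => ->; case: pickP => //= /(_ (k, l)); rewrite Ekl eqxx.
Qed.

(** Parameters are indexed by vertices and vertex pairs because [C] need not be finite; colour
    classes are imposed by reading only the parameters at representatives. *)
Definition param := ('I_p + 'I_p * 'I_p)%type.

Section ParametrizedCovariance.
Variables (T : comNzRingType) (w : 'I_#|{: param}| -> T).

Definition param_L : 'M[T]_p :=
  \matrix_(i, j) if E i j then w (enum_rank (inr (repE i j) : param)) else 0.

Definition param_om : 'rV[T]_p := \row_i w (enum_rank (inl (repV i) : param)).

Definition param_cov : 'M[T]_p := cov param_L param_om.

End ParametrizedCovariance.

Lemma param_L0 (T : comNzRingType) (w : _ -> T) i j : ~~ E i j -> param_L w i j = 0.
Proof. by move=> nE; rewrite mxE (negPf nE). Qed.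

Lemma eq_param_cov (T : comNzRingType) (w w' : _ -> T) :
  w =1 w' -> param_cov w = param_cov w'.
Proof.
move=> ww; rewrite /param_cov.
have -> : param_L w = param_L w' by apply/matrixP=> i j; rewrite !mxE ww.
by have -> : param_om w = param_om w' by apply/matrixP=> i j; rewrite !mxE ww.
Qed.

Lemma rmorph_param_cov (T U : comNzRingType) (g : {rmorphism T -> U}) w :
  map_mx g (param_cov w) = param_cov (g \o w).
Proof.
rewrite /param_cov rmorph_cov.
have -> : map_mx g (param_L w) = param_L (g \o w).
  by apply/matrixP=> i j; rewrite !mxE; case: ifP => // _; rewrite rmorph0.
by have -> : map_mx g (param_om w) = param_om (g \o w) by apply/rowP=> i; rewrite !mxE.
Qed.

Lemma model_param_cov (v : _ -> R) :
  (forall k, 0 < v k) -> model E cV cE (param_cov v).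
Proof.
move=> v0; exists (param_L v), (param_om v 0); split.
- exact: param_L0.
- by move=> i; rewrite mxE.
- by move=> i k ik; rewrite !mxE (eq_repV ik).
- by move=> i j k l Eij Ekl c; rewrite !mxE Eij Ekl (eq_repE Ekl c).
have -> : \matrix_(i, j) param_L v i j = param_L v by apply/matrixP=> i j; rewrite mxE.
have -> : \row_i param_om v 0 i = param_om v by apply/rowP=> i; rewrite mxE.
by rewrite /param_cov cov_invmx //; apply/DAG_upper/param_L0.
Qed.

(** The composite [F] of [f] with the generic parametrization is a polynomial, because [cov] uses
    adjugates. It vanishes at positive real parameters, which give model matrices, hence at all
    parameters in [D]. *)
Lemma vanishing_param_cov (D : idomainType) (g : {rmorphism R -> D}) (f : polyS R p)
    (w : _ -> D) : vanishing_ideal E cV cE f ->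
  mmap g (fun k => param_cov w (val (enum_val k)).1 (val (enum_val k)).2) f = 0.
Proof.
move=> f0; pose m := #|{: param}|.
pose F : {mpoly R[m]} := mmap (@mpolyC m R) (fun k =>
  param_cov (fun i => 'X_i : {mpoly R[m]}) (val (enum_val k)).1 (val (enum_val k)).2) f.
have FE (U : comNzRingType) (h : {rmorphism R -> U}) (u : 'I_m -> U) :
    mmap h u F =
    mmap h (fun k => param_cov u (val (enum_val k)).1 (val (enum_val k)).2) f.
  rewrite rmorph_mmap; apply: eq_mmap => [c|k] /=; first by rewrite mmapC.
  set e := val _; have := rmorph_param_cov (mmap h u) (fun i => 'X_i).
  move=> /matrixP/(_ e.1 e.2); rewrite mxE => ->.
  by rewrite (@eq_param_cov _ _ u) // => i /=; rewrite mmapX mmap1U.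
rewrite -FE; apply: mmap_eq0_of_pos => v v0.
by rewrite /meval FE; apply: f0; apply: model_param_cov.
Qed.

End ColoredDAG.

(** * The generic covariance matrix modulo the ideal *)

Section GenericCovariance.
Variables (R : realType) (p : nat) (E : rel 'I_p).
Variables (C : eqType) (cV : 'I_p -> C) (cE : 'I_p -> 'I_p -> C).
Hypothesis hnat : forall i j : 'I_p, E i j -> (i < j)%N.

Local Notation pa := (pa E).
Local Notation A := {mpoly R[nvars p]}.
Local Notation K := {fraction A}.
Local Notation "x %:F" := (@tofrac A x).
Local Notation M := (parental_mset (R := R) E).
Local Notation J := (ideal_gen (gens (R := R) E cV cE)).
Local Notation "x =~ y" := (eqloc M J x y) (at level 70).
Local Notation "B =~m D" := (eqlocmx M J B D) (at level 70).

Let M1 : M 1 := parental_mset1 R E.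
Let MM : forall s t, M s -> M t -> M (s * t) := @parental_msetM R p E.
Let J0 : J 0 := ideal_gen0 _.
Let JD : forall a b, J a -> J b -> J (a + b) := @ideal_genD R p _.
Let JM : forall a b, J b -> J (a * b) := @ideal_genM R p _.

(** The minor is nonzero at the model matrix with all parameters equal to 1. *)
Lemma parental_pminor_neq0 j : pminor R (pa j) != 0.
Proof.
have one_gt0 (k : 'I_#|{: param p}|) : 0 < (fun=> 1 : R) k by apply: ltr01.
have /(evalS_parental_mset hnat) nz := model_param_cov cV cE hnat one_gt0.
apply: contra_neq (nz _ (parental_mset_pminor R E j)) => ->.
exact: rmorph0.
Qed.

Definition SigF : 'M[K]_p := map_mx (@tofrac A) (Sig R p).

Lemma SigF_pminor B : pminor_of SigF B = (pminor R B)%:F.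
Proof. by rewrite pminor_ofE rmorph_pminor_of. Qed.

Lemma SigF_cminor i j B : cminor_of SigF i j B = (cminor R i j B)%:F.
Proof. by rewrite cminor_ofE rmorph_cminor_of. Qed.

Lemma SigF_regression : exists x : 'I_p -> 'I_p -> K,
  (forall k j, ~~ E k j -> x k j = 0) /\
  (forall j a, a \in pa j -> SigF a j = \sum_(k in pa j) SigF a k * x k j).
Proof.
have /fin_all_exists[y yP] : forall j, exists y : 'I_p -> K,
    (forall k, k \notin pa j -> y k = 0) /\
    (forall a, a \in pa j -> SigF a j = \sum_(k in pa j) SigF a k * y k).
  move=> j; apply: pminor_of_solve.
  by rewrite SigF_pminor tofrac_eq0 parental_pminor_neq0.
exists (fun k j => y j k); split=> [k j nE|j a aj].
  by have [y0 _] := yP j; apply: y0; rewrite inE.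
by have [_] := yP j; apply.
Qed.

(** Above the diagonal, [U = SigF *m (1%:M - L)] is 0 at an edge by the regression equations, and at
    a non-edge it is a conditional independence generator over a parental minor. Its diagonal holds
    the residual variances. The hypothesis on [L] says that its entries lie in the localization. *)
Lemma SigF_congr_diag (x : 'I_p -> 'I_p -> K) :
    (forall k j, ~~ E k j -> x k j = 0) ->
    (forall j a, a \in pa j -> SigF a j = \sum_(k in pa j) SigF a k * x k j) ->
  let L := \matrix_(i, j) x i j in
  L =~m L -> (1%:M - L)^T *m SigF *m (1%:M - L) =~m
    diag_mx (\row_j ((pminor R (j |: pa j))%:F / (pminor R (pa j))%:F)).
Proof.
move=> x0 xP L LL; set om := \row_j _; set D := _ *m _ *m _.
have pm0 j : (pminor R (pa j))%:F != 0 by rewrite tofrac_eq0 parental_pminor_neq0.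
have Lup : forall i j : 'I_p, (j <= i)%N -> L i j = 0.
  by apply: (DAG_upper hnat) => i j nE; rewrite mxE x0.
have L1 : 1%:M - L =~m 1%:M - L by apply: eqlocmxB => //; apply: eqlocmx1.
have [U UD] : exists U, U = SigF *m (1%:M - L) by exists (SigF *m (1%:M - L)).
have UE i j : U i j = SigF i j - \sum_(k in pa j) SigF i k * x k j.
  rewrite UD mulmxBr mulmx1 mxE [in X in _ + X]mxE [in X in _ - X]mxE.
  congr (_ - _); rewrite [RHS]big_mkcond; apply: eq_bigr => k _.
  by rewrite [L k j]mxE inE; case: ifPn => // nE; rewrite x0 ?mulr0.
have Uomega j : U j j = om 0 j.
  rewrite mxE -!SigF_pminor (pminor_of_regression hnat xP) -UE mulrC mulKf //.
  by rewrite SigF_pminor.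
have Ulow (i j : 'I_p) : (i < j)%N -> U i j =~ 0.
  move=> ij; have [Eij|nE] := boolP (E i j).
    by rewrite UE xP ?inE // subrr; apply: eqloc0.
  have -> : U i j = (cminor R i j (pa j))%:F / (pminor R (pa j))%:F.
    rewrite -SigF_cminor -SigF_pminor (cminor_of_regression xP) -UE mulrC mulKf //.
    by rewrite SigF_pminor.
  have -> : (0 : K) = 0%:F / 1%:F by rewrite tofrac0 mul0r.
  apply: eqloc_div; rewrite ?parental_pminor_neq0 ?oner_neq0 //.
    exact: parental_mset_pminor.
  by rewrite mulr1 mul0r subr0; apply: ideal_gen_mem; left; exists i, j.
have UU : U =~m U.
  by rewrite UD; apply: eqlocmxM => // i j; rewrite mxE; apply: eqloc_tofrac.
have oneL (i k : 'I_p) : (i <= k)%N -> (1%:M - L) k i = (k == i)%:R.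
  by move=> ik; rewrite mxE [in X in _ + X]mxE Lup // subr0 mxE.
have Dup (i j : 'I_p) : (i <= j)%N -> D i j =~ diag_mx om i j.
  move=> ij; rewrite /D -mulmxA -UD mxE.
  (* The product is compared term by term: for [k < j] the factor [U k j] is congruent to 0, for
     [k > j] the factor [(1%:M - L) k i] is 0, and [k = j] yields the diagonal entry. The part below
     the diagonal follows by symmetry. *)
  have -> : diag_mx om i j = \sum_k (if k == j then diag_mx om i j else 0).
    by rewrite -big_mkcond big_pred1_eq.
  apply: eqloc_sum => // k; rewrite [_^T _ _]mxE.
  have [kj|jk|/val_inj ->] := ltngtP k j.
  - have -> : (if k == j then diag_mx om i j else 0) = (1%:M - L) k i * 0.
      by rewrite -val_eqE /= ltn_eqF // mulr0.
    by apply: eqlocM => //; apply: Ulow.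
  - rewrite oneL ?(leq_trans ij (ltnW jk)) //.
    rewrite -!val_eqE /= !gtn_eqF ?(leq_ltn_trans ij) //.
    by rewrite mul0r; apply: eqloc0.
  - rewrite oneL // eqxx [diag_mx _ _ _]mxE eq_sym.
    by case: eqP => [->|_]; rewrite ?mul1r ?mul0r -?Uomega //; apply: eqloc0.
move=> i j; have [ij|ji] := leqP i j; first exact: Dup.
have Dsym : D^T = D by rewrite /D !trmx_mul trmxK /SigF map_trmx Sig_sym mulmxA.
by rewrite -Dsym -[diag_mx om]tr_diag_mx ![_^T _ _]mxE; apply/Dup/ltnW.
Qed.

Lemma SigF_param_cov : exists w, SigF =~m param_cov E cV cE w.
Proof.
have [x [x0 xP]] := SigF_regression.
have pm0 j : (pminor R (pa j))%:F != 0 by rewrite tofrac_eq0 parental_pminor_neq0.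
have xE i j : E i j -> x i j = (cminor R i j (pa j :\ i))%:F / (pminor R (pa j))%:F.
  move=> Eij; rewrite -SigF_cminor (cminor_of_coefficient xP) //.
  by rewrite SigF_pminor mulrC mulKf.
pose om := \row_j ((pminor R (j |: pa j))%:F / (pminor R (pa j))%:F).
pose L := \matrix_(i, j) x i j.
(* Parameters are the residual variances and regression coefficients of the generic matrix; the
   colour generators make each of them congruent to the value at its representative. *)
pose w (k : 'I_#|{: param p}|) := match enum_val k : param p with
  | inl i => om 0 i | inr e => x e.1 e.2 end.
have HL : L =~m param_L E cE w.
  move=> i j; rewrite !mxE; case: ifPn => [Eij|/x0 ->]; last exact: eqloc0.
  have [Ee ce] := repE_color cE Eij.
  rewrite /w enum_rankK !xE //.
  apply: eqloc_div; rewrite ?parental_pminor_neq0 //; try exact: parental_mset_pminor.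
  apply: ideal_gen_mem; right; right; exists i, j, (repE E cE i j).1, (repE E cE i j).2.
  by split.
have Hom : diag_mx om =~m diag_mx (param_om cV w).
  move=> i j; rewrite !mxE; case: eqP => [_|_]; last exact: eqloc0.
  rewrite /w enum_rankK mxE !mulr1n.
  apply: eqloc_div; rewrite ?parental_pminor_neq0 //; try exact: parental_mset_pminor.
  apply: ideal_gen_mem; right; left; exists i, (repV cV i).
  by rewrite repV_color.
exists w; set L' := param_L E cE w.
have L'up : forall i j : 'I_p, (j <= i)%N -> L' i j = 0.
  by apply: (DAG_upper hnat) => i j; apply: param_L0.
have LL' : L' =~m L by move=> i j; apply: eqloc_sym.
(* Going to [L'] and back shows that the entries of [L] lie in the localization. *)
have LL : L =~m L by apply: eqlocmx_trans LL'.
have sub1 (B D : 'M[K]_p) : B =~m D -> 1%:M - B =~m 1%:M - D.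
  by move=> BD; apply: eqlocmxB => //; apply: eqlocmx1.
have HA : \adj (1%:M - L') =~m \adj (1%:M - L').
  by apply/eqlocmx_adj/sub1 => //; apply: eqlocmx_trans HL.
(* The exact identity is taken with [L'], so that the outer factors already are those of
   [param_cov]; only the inner factor has to pass from [L'] to [L]. *)
rewrite (cov_congr L'up SigF); apply: eqlocmxM => //.
apply: eqlocmxM => //; first exact: eqlocmx_tr.
apply: eqlocmx_trans Hom => //; apply: eqlocmx_trans (SigF_congr_diag x0 xP LL) => //.
apply: eqlocmxM => //; last exact: sub1.
apply: eqlocmxM => //; first by apply/eqlocmx_tr/sub1.
by move=> i j; rewrite mxE; apply: eqloc_tofrac.
Qed.

(** The polynomial [f] is its own value at the generic matrix, hence congruent to its value at
    [param_cov], which is 0. *)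
Lemma vanishing_colon (f : polyS R p) : vanishing_ideal E cV cE f -> colon J M f.
Proof.
move=> f0; apply: eqloc_colon.
have [w Sw] := SigF_param_cov.
rewrite -[in X in X =~ _](mmap_polyX f) rmorph_mmap.
rewrite -(vanishing_param_cov hnat (@tofrac A \o @mpolyC _ R) w f0).
apply: eqloc_mmap => // k /=; rewrite -Sig_enum_val.
by have := Sw (val (enum_val k)).1 (val (enum_val k)).2; rewrite mxE.
Qed.

End GenericCovariance.

Theorem theorem4p9 (R : realType) (p : nat) (E : rel 'I_p)
    (C : eqType) (cV : 'I_p -> C) (cE : 'I_p -> 'I_p -> C)
    (hnat : forall i j : 'I_p, E i j -> (i < j)%N)
    (hdisj : forall i k l : 'I_p, E k l -> cV i <> cE k l) :
  forall f : polyS R p,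
    vanishing_ideal E cV cE f <->
    colon (ideal_gen (gens E cV cE)) (parental_mset E) f.
Proof.
by move=> f; split; [exact: vanishing_colon | exact: colon_vanishing].
Qed.
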